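(* Let $\mathcal{M}=(\mathcal{S},\mathcal{A},f,r,\gamma)$ be a Markov decision process, $\pi_\theta$ a differentiable (stochastic) policy, $H$ a finite horizon and $\gamma\in[0,1)$. Let $b:\mathcal{S}\times\mathcal{A}\to\mathbb{R}$ be a reward bias function, define $\tilde r(s,a):=r(s,a)+b(s,a)$, and define $\tilde{\mathcal{M}}:=(\mathcal{S},\mathcal{A},f,\tilde r,\gamma)$. For trajectories sampled by executing $\pi_\theta$ under the true dynamics $f$, let $\tilde g^{(1)},\dots,\tilde g^{(K)}$ be independent REINFORCE estimators (as defined in the context) computed using the biased rewards $\tilde r(s_t,a_t)$, and define $\tilde g:=\frac1K\sum_{k=1}^K\tilde g^{(k)}$. Define $B_H(\theta):=\mathbb{E}\bigl[\sum_{t=0}^{H-1}\gamma^t b(s_t,a_t)\bigr]$, where the expectation is over trajectories generated by executing $\pi_\theta$ under the true dynamics $f$. Then $$\mathbb{E}[\tilde g]=\nabla_\theta J_H(\pi_\theta,\tilde{\mathcal{M}})=g_H+\nabla_\theta B_H(\theta).$$ If $\mathrm{Var}[\tilde g^{(1)}]<\infty$, then $$\mathbb{E}\bigl[\|\tilde g-g_H\|^2\bigr]=\frac1K\mathrm{Var}[\tilde g^{(1)}]+\|\nabla_\theta B_H(\theta)\|^2 .$$ Consequently, when $\nabla_\theta B_H(\theta)\ne0$, averaging over more trajectories reduces the variance term but does not remove the bias of $\tilde g$ as an estimator of $g_H$.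
   Context: $\mathcal{S}\subseteq\mathbb{R}^{d_s}$, $\mathcal{A}\subseteq\mathbb{R}^{d_a}$, the dynamics $f:\mathcal{S}\times\mathcal{A}\to\mathcal{S}$ are deterministic, $r:\mathcal{S}\times\mathcal{A}\to\mathbb{R}$ is the true reward, and $s_0$ is the initial state. For a parameter $\theta\in\mathbb{R}^d$, $\pi_\theta(\cdot\mid s)$ is a probability mass function or density on $\mathcal{A}$, differentiable in $\theta$. A trajectory is generated by $a_t\sim\pi_\theta(\cdot\mid s_t)$, $s_{t+1}=f(s_t,a_t)$. $\|\cdot\|$ is the Euclidean norm. The standard policy-gradient assumptions (integrability, and interchange of differentiation and expectation) are in force. $J_H(\pi_\theta,\mathcal{M}):=\mathbb{E}[\sum_{t=0}^{H-1}\gamma^t r(s_t,a_t)]$, $g_H:=\nabla_\theta J_H(\pi_\theta,\mathcal{M})$, and $J_H(\pi_\theta,\tilde{\mathcal{M}})$ is the same with $\tilde r$ in place of $r$. With $\tilde G_t:=\sum_{t'=t}^{H-1}\gamma^{t'-t}\tilde r(s_{t'},a_{t'})$, the single-trajectory REINFORCE estimator using biased rewards is $$\sum_{t=0}^{H-1}\nabla_\theta\log\pi_\theta(a_t\mid s_t)\,\tilde G_t ,$$ and $\tilde g^{(k)}$ is this quantity computed on the $k$th of $K\ge1$ independent trajectories. For a random vector $z=(z_1,\dots,z_d)$, $\mathrm{Var}[z]:=\sum_{i=1}^d\mathrm{Var}[z_i]$.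
   Formalization: The REINFORCE estimator is taken with an extra factor γ^t on the t-th term, i.e. Σ_t γ^t ∇log π_θ(a_t|s_t) G̃_t; without it the estimator is in general biased for ∇J_H when H ≥ 2 and γ < 1, so the displayed identities fail. *)

(* Defs.v *)
From HB Require Import structures.
From mathcomp Require Import all_boot all_order all_algebra.
From mathcomp Require Import all_classical all_reals all_analysis.

Set Implicit Arguments.
Unset Strict Implicit.
Unset Printing Implicit Defensive.

Import Order.TTheory GRing.Theory Num.Theory.
Import numFieldNormedType.Exports.

Local Open Scope classical_set_scope.
Local Open Scope ring_scope.

(* R^n as a measurable space.  The library's sigma-algebra on tuples is the
   product of the Borel sigma-algebras of the factors. *)
Notation euclidean R n := (n.-tuple (measurableTypeR R)).

(* The library proves this too, but its sigma-finite instance on [m1 \x m2] is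
   shadowed by the one for subprobabilities and cannot be inferred. *)
Lemma product_sigma_finite d1 d2 (T1 : measurableType d1)
    (T2 : measurableType d2) (R : realType)
    (m1 : {sigma_finite_measure set T1 -> \bar R})
    (m2 : {sigma_finite_measure set T2 -> \bar R}) :
  sigma_finite setT (m1 \x m2)%E.
Proof.
have /sigma_finiteP[F [TF ndF Foo]] := sigma_finiteT m1.
have /sigma_finiteP[G [TG ndG Goo]] := sigma_finiteT m2.
exists (fun n => F n `*` G n).
  rewrite -setXTT TF TG predeqE => -[x y]; split.
    move=> [/= [n _ Fnx] [k _ Gky]]; exists (maxn n k) => //; split.
    - by move: x Fnx; exact/subsetPset/ndF/leq_maxl.
    - by move: y Gky; exact/subsetPset/ndG/leq_maxr.
  by move=> [n _ []/= ? ?]; split; exists n.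
move=> k; have [? ?] := Foo k; have [? ?] := Goo k.
split; first exact: measurableX.
by rewrite product_measure1E// lte_mul_pinfty// ge0_fin_numE.
Qed.

Section power_measure.
Context d (T : measurableType d) (R : realType).

Definition tcons n (x : T * n.-tuple T) : n.+1.-tuple T :=
  [tuple of x.1 :: x.2].

Lemma measurable_tcons n :
  measurable_fun [set: T * n.-tuple T] (@tcons n).
Proof. exact: measurable_cons. Qed.

Section cons_measure.
Context n (mu : {sigma_finite_measure set T -> \bar R})
  (nu : {sigma_finite_measure set (n.-tuple T) -> \bar R}).

Definition cons_measure : set (n.+1.-tuple T) -> \bar R :=
  pushforward (mu \x nu)%E (@tcons n).

Let cons_measure0 : cons_measure set0 = 0%E.
Proof. by rewrite /cons_measure /pushforward preimage_set0 measure0. Qed.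

Let cons_measure_ge0 B : (0 <= cons_measure B)%E.
Proof. exact: (measure_ge0 (mu \x nu)%E). Qed.

Let cons_measure_sigma_additive : semi_sigma_additive cons_measure.
Proof.
move=> F mF tF mUF; rewrite /cons_measure /pushforward preimage_bigcup.
have mpre B : measurable B -> measurable (@tcons n @^-1` B).
  by move=> mB; rewrite -[X in measurable X]setTI; exact: measurable_tcons.
apply: (@measure_semi_sigma_additive _ _ _ (mu \x nu)%E).
- by move=> k; exact: mpre.
- apply/trivIsetP => i j _ _ ij; rewrite -preimage_setI.
  by move/trivIsetP : tF => ->//; rewrite preimage_set0.
- by rewrite -preimage_bigcup; exact: mpre.
Qed.

HB.instance Definition _ := isMeasure.Build _ _ _ cons_measure
  cons_measure0 cons_measure_ge0 cons_measure_sigma_additive.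

Let cons_measure_sigma_finite : sigma_finite setT cons_measure.
Proof.
have [F TF Foo] : sigma_finite setT (mu \x nu)%E.
  exact: product_sigma_finite.
pose uncons (u : n.+1.-tuple T) : T * n.-tuple T := (thead u, [tuple of behead u]).
have muncons : measurable_fun [set: n.+1.-tuple T] uncons.
  apply/measurable_fun_pair; last exact: measurable_behead.
  exact: measurable_tnth.
have consK : cancel (@tcons n) uncons.
  by case=> a v; congr pair; apply/val_inj.
exists (fun k => uncons @^-1` F k).
  by rewrite -preimage_bigcup -TF preimage_setT.
move=> k; have [mF Fk] := Foo k; split.
  by rewrite -[X in measurable X]setTI; exact: muncons.
rewrite /cons_measure /pushforward -comp_preimage.
by rewrite (_ : uncons \o _ = id) ?preimage_id//; apply/funext.
Qed.

HB.instance Definition _ := Measure_isSigmaFinite.Build _ _ _ cons_measure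
  cons_measure_sigma_finite.

End cons_measure.

Fixpoint power_measure (mu : {sigma_finite_measure set T -> \bar R}) n :
    {sigma_finite_measure set (n.-tuple T) -> \bar R} :=
  if n is n'.+1 then cons_measure mu (power_measure mu n')
  else dirac ([tuple] : 0.-tuple T).

End power_measure.

Section vectors.
Context (R : realType) (d : nat).

(* The library's norm on 'rV[R]_d is the sup norm. *)
Definition norm2 (v : 'rV[R]_d) : R := Num.sqrt (\sum_(i < d) v 0 i ^+ 2).

Definition grad (F : 'rV[R]_d -> R) (theta : 'rV[R]_d) : 'rV[R]_d :=
  \row_(i < d) 'D_('e_i) F theta.

Definition total_variance dO (Omega : measurableType dO)
    (P : probability Omega R) (Z : Omega -> 'rV[R]_d) : \bar R :=
  (\sum_(i < d) 'V_P[fun w => Z w 0%R i])%E.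

End vectors.

Section independence.
Context (R : realType) dO (Omega : measurableType dO) (P : probability Omega R).
Context dT (T : measurableType dT).

(* Taking some [B k] equal to [setT] gives the product rule for subfamilies. *)
Definition mutually_independent K (X : 'I_K -> {RV P >-> T}) : Prop :=
  forall B : 'I_K -> set T, (forall k, measurable (B k)) ->
    P (\bigcap_(k in [set: 'I_K]) (X k @^-1` B k)) =
    (\prod_(k < K) P (X k @^-1` B k))%E.

End independence.

(* A Markov decision process with deterministic dynamics, in which the states and
   the actions range over subsets of Euclidean spaces. *)
Record mdp (R : realType) (ds da : nat) := Mdp {
  states : set (euclidean R ds) ;
  actions : set (euclidean R da) ;
  dynamics : euclidean R ds -> euclidean R da -> euclidean R ds ;
  reward : euclidean R ds -> euclidean R da -> R ;
  discount : R }.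

Definition with_bias (R : realType) (ds da : nat) (M : mdp R ds da)
    (b : euclidean R ds -> euclidean R da -> R) : mdp R ds da :=
  Mdp (states M) (actions M) (dynamics M)
    (fun s a => reward M s a + b s a) (discount M).

Section policy_gradient.
Context (R : realType) (ds da d : nat).
Local Notation state := (euclidean R ds).
Local Notation action := (euclidean R da).
Local Notation param := 'rV[R]_d.

Record mdp_wf (M : mdp R ds da) : Prop := {
  states_measurable : measurable (states M) ;
  actions_measurable : measurable (actions M) ;
  dynamics_states : forall s a,
    states M s -> actions M a -> states M (dynamics M s a) ;
  dynamics_measurable : measurable_fun (states M `*` actions M)
    (fun x : state * action => dynamics M x.1 x.2) ;
  reward_measurable : measurable_fun (states M `*` actions M)
    (fun x : state * action => reward M x.1 x.2) ;
  discount_range : 0 <= discount M < 1 }.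

(* [pi theta s a] is the value at [a] of the density of pi_theta(. | s) with
   respect to [mu]: a density when [mu] is Lebesgue measure, a probability mass
   function when [mu] is the counting measure on a countable action set. *)
Record is_policy (M : mdp R ds da)
    (mu : {sigma_finite_measure set action -> \bar R})
    (pi : param -> state -> action -> R) : Prop := {
  policy_ge0 : forall theta s a,
    states M s -> actions M a -> 0 <= pi theta s a ;
  policy_measurable : forall theta, measurable_fun (states M `*` actions M)
    (fun x : state * action => pi theta x.1 x.2) ;
  policy_total : forall theta s, states M s ->
    (\int[mu]_(a in actions M) (pi theta s a)%:E = 1)%E ;
  policy_differentiable : forall theta s a, states M s -> actions M a ->
    differentiable (fun theta' => pi theta' s a) theta }.

Definition score (pi : param -> state -> action -> R) (theta : param)
    (s : state) (a : action) : param :=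
  grad (fun theta' => ln (pi theta' s a)) theta.

Context (M : mdp R ds da) (s0 : state).
Context (mu : {sigma_finite_measure set action -> \bar R}).
Context (pi : param -> state -> action -> R) (H : nat).
Local Notation gamma := (discount M).
Implicit Types (rho : state -> action -> R) (u : H.-tuple action).

(* The dynamics being deterministic, a trajectory is determined by [s0] and the
   tuple [u] of its actions. *)
Definition state_at u (t : 'I_H) : state := foldl (dynamics M) s0 (take t u).

Definition trajectories : set (H.-tuple action) :=
  [set u | forall t, actions M (tnth u t)].

(* The joint density of (a_0, ..., a_(H-1)) when a_t ~ pi_theta(. | s_t) and
   s_(t+1) = f(s_t, a_t), with respect to the power of [mu]. *)
Definition trajectory_density (theta : param) u : R :=
  \prod_(t < H) pi theta (state_at u t) (tnth u t).

Definition trajectory_expectation (theta : param) (F : H.-tuple action -> R) : R :=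
  \int[power_measure mu H]_(u in trajectories) (trajectory_density theta u * F u).

Definition discounted_sum rho u : R :=
  \sum_(t < H) gamma ^+ t * rho (state_at u t) (tnth u t).

Definition expected_return rho (theta : param) : R :=
  trajectory_expectation theta (discounted_sum rho).

Definition J : param -> R := expected_return (reward M).

Definition reward_to_go u (t : 'I_H) : R :=
  \sum_(t' < H | (t <= t')%N)
    gamma ^+ (t' - t) * reward M (state_at u t') (tnth u t').

(* The weight gamma^t is what makes this estimator unbiased for the gradient of
   the discounted objective [J]: the gradient of E[gamma^t' r(s_t', a_t')] is
   E[gamma^t' r(s_t', a_t') sum_(t <= t') grad log pi_theta(a_t | s_t)], while
   [reward_to_go] at time t only discounts by gamma^(t' - t).  The variant
   without gamma^t is in general biased once H >= 2, even for exact rewards. *)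
Definition reinforce (theta : param) u : param :=
  \sum_(t < H) (gamma ^+ t * reward_to_go u t) *:
    score pi theta (state_at u t) (tnth u t).

Record policy_regular (theta : param) : Prop := {
  score_measurable : forall i, measurable_fun (states M `*` actions M)
    (fun x : state * action => score pi theta x.1 x.2 0 i) ;
  policy_derivative_integrable : forall i s, states M s ->
    mu.-integrable (actions M)
      (fun a => ('D_('e_i) (fun theta' => pi theta' s a) theta)%:E) ;
  policy_interchange : forall i s, states M s ->
    is_derive theta 'e_i
      (fun theta' => \int[mu]_(a in actions M) pi theta' s a)
      (\int[mu]_(a in actions M) 'D_('e_i) (fun theta' => pi theta' s a) theta) }.

Record reward_regular rho (theta : param) : Prop := {
  reward_integrable : forall theta' (t : 'I_H),
    (power_measure mu H).-integrable trajectories (fun u =>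
      (trajectory_density theta' u * rho (state_at u t) (tnth u t))%:E) ;
  score_reward_integrable : forall i (t t' : 'I_H),
    (power_measure mu H).-integrable trajectories (fun u =>
      (trajectory_density theta u *
        (score pi theta (state_at u t) (tnth u t) 0 i *
         rho (state_at u t') (tnth u t')))%:E) ;
  return_interchange : forall i,
    is_derive theta 'e_i (expected_return rho)
      (\int[power_measure mu H]_(u in trajectories)
        ('D_('e_i) (trajectory_density ^~ u) theta * discounted_sum rho u)) }.

Record iid_trajectories (theta : param) dO (Omega : measurableType dO)
    (P : probability Omega R) (K : nat)
    (tau : 'I_K -> {RV P >-> H.-tuple action}) : Prop := {
  iid_values : forall k w, trajectories (tau k w) ;
  iid_law : forall k (B : set (H.-tuple action)), measurable B ->
    distribution P (tau k) B =
    (\int[power_measure mu H]_(u in trajectories `&` B)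
       (trajectory_density theta u)%:E)%E ;
  iid_independent : mutually_independent tau }.

Definition averaged_reinforce (theta : param) (Omega : Type) (K : nat)
    (tau : 'I_K -> Omega -> H.-tuple action) (w : Omega) : param :=
  K%:R^-1 *: \sum_(k < K) reinforce theta (tau k w).

End policy_gradient.

(* Main.v *)
(* The score has mean zero given the past, being the derivative of the constant
   total mass of the policy.  Hence the products of the score at time t with the
   rewards received before t integrate to zero, and adding them turns the mean of
   the REINFORCE estimator into the derivative of the expected return of the
   biased rewards, which is linear in the reward.  The mean of K independent copies
   has variance divided by K, and expanding the square around the mean g + grad B
   gives the decomposition of the mean squared error. *)

Require Import Defs.
From HB Require Import structures.
From mathcomp Require Import all_boot all_order all_algebra.
From mathcomp Require Import all_classical all_reals all_analysis.
From mathcomp Require Import measurable_realfun.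

Set Implicit Arguments.
Unset Strict Implicit.
Unset Printing Implicit Defensive.

Import Order.TTheory GRing.Theory Num.Theory.
Import numFieldNormedType.Exports.

Local Open Scope classical_set_scope.
Local Open Scope ring_scope.

(** Expectations live on an abstract sample space, whereas regularity is assumed about integrals
    over actions. Since the law of a trajectory is known only through its density, every expectation
    is transported to an integral over tuples of actions. There, conditioning on the past is
    replaced by Fubini over the first action and induction on the horizon, for which the integrand
    must be a product of one factor per time step. Fubini makes sections integrable only for almost
    every first action, so the induction works up to null sets. Zeros of the policy, where [ln]
    takes a default value, are harmless because a nonnegative differentiable function has zero
    derivative there. The statements on the estimator concern a process and its own reward and are
    applied to the biased process; the true gradient enters only as the centre of the squared
    error. *)

(** * Integrals against a law given by a density *)

Section density.
Context {R : realType} d (T : measurableType d).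
Context (m nu : {measure set T -> \bar R}) (D : set T) (p : T -> R).
Hypotheses (mD : measurable D) (mp : measurable_fun D p).
Hypothesis (p0 : forall x, D x -> 0 <= p x).
Hypothesis nuE : forall B, measurable B ->
  nu B = (\int[m]_(x in D `&` B) (p x)%:E)%E.

Variable f : T -> \bar R.
Hypotheses (mf : measurable_fun [set: T] f) (f0 : forall x, (0 <= f x)%E).

Import HBNNSimple.

(** Both sides are monotone limits along simple approximations of [f], and for a simple function the
    claim is [nuE] summed over its level sets. *)
Lemma ge0_integral_density :
  (\int[nu]_x f x = \int[m]_(x in D) ((p x)%:E * f x))%E.
Proof.
pose g := nnsfun_approx measurableT mf.
have gf x : EFin \o g ^~ x @ \oo --> f x by apply: cvg_nnsfun_approx.
transitivity (limn (fun n => \int[nu]_x (g n x)%:E))%E.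
  rewrite -monotone_convergence//.
  - by apply: eq_integral => x _; apply/esym/cvg_lim => //; exact: gf.
  - by move=> n; exact/measurable_EFinP.
  - by move=> n x _; rewrite lee_fin.
  - by move=> x _ a b ab; rewrite lee_fin; exact/lefP/nd_nnsfun_approx.
transitivity (limn (fun n => \int[m]_(x in D) ((p x)%:E * (g n x)%:E)))%E; last first.
  rewrite -monotone_convergence//.
  - apply: eq_integral => x /[!inE] Dx; apply/cvg_lim => //.
    by apply: cvgeZl => //; exact: gf.
  - move=> n; apply: emeasurable_funM; first exact/measurable_EFinP.
    exact/measurable_EFinP/measurable_funTS.
  - by move=> n x Dx; rewrite mule_ge0// lee_fin ?p0.
  - move=> x Dx a b ab; rewrite lee_pmul// ?lee_fin// ?p0//.
    exact/lefP/nd_nnsfun_approx.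
congr (limn _); apply/funext => n.
have mpD : measurable_fun D (EFin \o p) by exact/measurable_EFinP.
transitivity (\sum_(k \in range (g n)) (k%:E * nu (g n @^-1` [set k])))%E.
  under eq_integral do rewrite fimfunE -fsumEFin//.
  rewrite ge0_integral_fsum//; last 2 first.
  - by move=> y; exact/measurable_EFinP/measurable_funM.
  - by move=> y x _; rewrite nnfun_muleindic_ge0.
  apply: eq_fsbigr => r _; rewrite integralZl_indic_nnsfun// integral_indic//.
  by rewrite setIT.
transitivity (\sum_(k \in range (g n))
   \int[m]_(x in D) (k%:E * ((EFin \o p) \_ (g n @^-1` [set k])) x))%E.
  apply: eq_fsbigr => r /[!inE] -[x0 _ <-].
  rewrite nuE// integral_mkcondr ge0_integralZl_EFin//.
  - by move=> x Dx; rewrite patchE; case: ifPn => // _; rewrite lee_fin p0.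
  - apply/measurable_restrict => //.
    by apply: measurable_funS mpD.
rewrite -ge0_integral_fsum//.
- apply: eq_integral => x xD.
  rewrite [in RHS]fimfunE -fsumEFin// ge0_mule_fsumr; last first.
    by move=> r; rewrite nnfun_muleindic_ge0.
  apply: eq_fsbigr => r _; rewrite patchE indicE.
  by case: ifPn => _ /=; rewrite ?mulr1 ?mulr0 ?mule0// muleC.
- move=> k; apply: emeasurable_funM => //.
  by apply/measurable_restrict => //; apply: measurable_funS mpD.
(* The bound is asked for every real [k]: on its level set [k] is the value [g n x], hence
   nonnegative, and off it the product is zero. *)
- move=> k x Dx; rewrite patchE; case: ifPn => xk; last by rewrite mule0.
  by rewrite inE/= in xk; rewrite -xk mule_ge0// lee_fin ?p0.
Qed.

End density.

Section law.
Context {R : realType} d (T : measurableType d) (m : {measure set T -> \bar R}).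
Context (D : set T) (p : T -> R).
Context dO (Omega : measurableType dO) (P : probability Omega R).
Context (X : {RV P >-> T}).
Hypotheses (mD : measurable D) (mp : measurable_fun D p).
Hypothesis (p0 : forall x, D x -> 0 <= p x).
Hypothesis XD : forall w, D (X w).
Hypothesis lawX : forall B, measurable B ->
  distribution P X B = (\int[m]_(x in D `&` B) (p x)%:E)%E.

Lemma measurable_comp_law d' (T' : measurableType d') (F : T -> T') :
  measurable_fun D F -> measurable_fun [set: Omega] (F \o X).
Proof.
by move=> mF; apply: (measurable_comp mD) => // _ [w _ <-]; exact: XD.
Qed.

(** [F] is controlled only on [D], so it is replaced by its extension by zero, which agrees with it
    along [X] because [X] never leaves [D]. *)
Lemma ge0_integral_law (F : T -> \bar R) : measurable_fun D F ->
  (forall x, D x -> 0 <= F x)%E ->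
  (\int[P]_w F (X w) = \int[m]_(x in D) ((p x)%:E * F x))%E.
Proof.
move=> mF F0.
transitivity (\int[P]_w (F \_ D \o X) w)%E.
  by apply: eq_integral => w _ /=; rewrite patchE mem_set.
have mFD : measurable_fun [set: T] (F \_ D) by exact/(measurable_restrictT _ mD).
have FD0 x : (0 <= (F \_ D) x)%E.
  by rewrite patchE; case: ifPn => // /[!inE] /F0.
rewrite -ge0_integral_distribution// (ge0_integral_density mD mp p0 lawX)//.
by apply: eq_integral => x xD; rewrite patchE xD.
Qed.

Lemma integrable_law (F : T -> R) : measurable_fun D F ->
  m.-integrable D (fun x => (p x * F x)%:E) ->
  P.-integrable setT (fun w => (F (X w))%:E).
Proof.
move=> mF /integrableP[_ pFoo]; apply/integrableP; split.
  exact/measurable_EFinP/measurable_comp_law.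
rewrite (ge0_integral_law (F := fun x => `|(F x)%:E|%E))//; last first.
  by apply: measurableT_comp => //; exact/measurable_EFinP.
apply: le_lt_trans pFoo; rewrite le_eqVlt; apply/orP; left; apply/eqP.
by apply: eq_integral => x /[!inE] /p0 px; rewrite EFinM abseM (gee0_abs (x := (p x)%:E)).
Qed.

(** Multiplying by [p >= 0] commutes with taking positive and negative parts, so the nonnegative
    case applies to each part separately. *)
Lemma integral_law (F : T -> R) : measurable_fun D F ->
  (\int[P]_w (F (X w))%:E = \int[m]_(x in D) (p x * F x)%:E)%E.
Proof.
move=> mF; have mFe : measurable_fun D (EFin \o F) by exact/measurable_EFinP.
rewrite [LHS]integralE [RHS]integralE; congr (_ - _)%E.
- transitivity (\int[P]_w ((EFin \o F)^\+)%E (X w))%E; first by apply: eq_integral => w _; rewrite unlock.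
  rewrite ge0_integral_law//; last exact: measurable_funepos.
  apply: eq_integral => x /[!inE] /p0 px.
  by rewrite unlock/= -!EFin_max -EFinM maxr_pMr// mulr0.
- transitivity (\int[P]_w ((EFin \o F)^\-)%E (X w))%E; first by apply: eq_integral => w _; rewrite unlock.
  rewrite ge0_integral_law//; last exact: measurable_funeneg.
  apply: eq_integral => x /[!inE] /p0 px.
  by rewrite unlock/= -!EFin_max -EFinM maxr_pMr// mulr0 mulrN.
Qed.

End law.

(** * Calculus of integrable functions with known integral; products of independent variables *)

Section has_integral.
Context {R : realType} d (T : measurableType d) (m : {measure set T -> \bar R}).
Context (D : set T).
Hypothesis mD : measurable D.
Implicit Types (f g : T -> R) (a b c : R).

(** Integrability travels with the value, so that finite linear combinations can be integrated
    without restating side conditions at every step. *)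
Definition has_integral f a :=
  m.-integrable D (EFin \o f) /\ (\int[m]_(x in D) (f x)%:E = a%:E)%E.

Lemma integrable_has_integral f : m.-integrable D (EFin \o f) ->
  has_integral f (\int[m]_(x in D) f x).
Proof. by move=> fi; split; rewrite // fineK// integrable_fin_num. Qed.

Lemma has_integral_Rintegral f a : has_integral f a -> \int[m]_(x in D) f x = a.
Proof. by rewrite /Rintegral => -[_ ->]. Qed.

Lemma eq_has_integral g f a : (forall x, D x -> f x = g x) ->
  has_integral f a -> has_integral g a.
Proof.
move=> fg [fi fE]; split.
  by apply: eq_integrable fi => // x /[!inE] Dx /=; rewrite fg.
by rewrite -fE; apply: eq_integral => x /[!inE] Dx; rewrite fg.
Qed.

Lemma has_integralD f g a b : has_integral f a -> has_integral g b ->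
  has_integral (fun x => f x + g x) (a + b).
Proof.
move=> [fi fE] [gi gE]; split; first exact: (integrableD mD fi gi).
by rewrite integralD_EFin// fE gE.
Qed.

Lemma has_integralZ c f a : has_integral f a ->
  has_integral (fun x => c * f x) (c * a).
Proof.
move=> [fi fE]; split; first exact: (integrableZl mD c fi).
by under eq_integral do rewrite EFinM; rewrite integralZl// fE.
Qed.

Lemma has_integral_sum I (s : seq I) (Q : pred I) (f : I -> T -> R) (a : I -> R) :
  (forall i, Q i -> has_integral (f i) (a i)) ->
  has_integral (fun x => \sum_(i <- s | Q i) f i x) (\sum_(i <- s | Q i) a i).
Proof.
move=> fa; elim: s => [|i s IH].
  rewrite big_nil; split.
    by under [X in _.-integrable _ X]eq_fun do rewrite /= big_nil; exact: integrable0.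
  by under eq_integral do rewrite big_nil; rewrite integral0.
rewrite big_cons; case: ifPn => Qi.
  apply: eq_has_integral (has_integralD (fa i Qi) IH) => x _.
  by rewrite big_cons Qi.
by apply: eq_has_integral IH => x _; rewrite big_cons (negbTE Qi).
Qed.

End has_integral.

Section has_mean.
Context {R : realType} d (T : measurableType d) (P : probability T R).
Implicit Types (X Y : T -> R) (a b c : R).
Local Notation has_mean X a := (has_integral P setT X a).

Lemma has_mean_expectation X a : has_mean X a -> 'E_P[X]%E = a%:E.
Proof. by rewrite unlock => -[]. Qed.

Lemma has_mean_cst c : has_mean (cst c) c.
Proof.
split; first exact: finite_measure_integrable_cst.
by rewrite -[LHS]/(\int[P]_w cst c%:E w)%E integral_cst//= probability_setT mule1.
Qed.

(** The joint law of [(X, Y)] agrees with the product of the two laws on rectangles, hence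
    everywhere; Fubini then factors the integral of [z.1 * z.2]. *)
Lemma has_meanM_independent X Y a b :
  has_mean X a -> has_mean Y b ->
  (forall A B : set (measurableTypeR R), measurable A -> measurable B ->
    P (X @^-1` A `&` Y @^-1` B) = (P (X @^-1` A) * P (Y @^-1` B))%E) ->
  has_mean (fun w => X w * Y w) (a * b).
Proof.
move=> [iX EX] [iY EY] indXY.
have mX : measurable_fun [set: T] (X : T -> measurableTypeR R).
  by apply/measurable_EFinP; exact: measurable_int iX.
have mY : measurable_fun [set: T] (Y : T -> measurableTypeR R).
  by apply/measurable_EFinP; exact: measurable_int iY.
have mXY : measurable_fun [set: T]
    (fun w => (X w, Y w) : measurableTypeR R * measurableTypeR R).
  exact: measurable_fun_pair.
pose pX : {RV P >-> measurableTypeR R} :=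
  HB.pack X (isMeasurableFun.Build _ _ _ _ _ mX).
pose pY : {RV P >-> measurableTypeR R} :=
  HB.pack Y (isMeasurableFun.Build _ _ _ _ _ mY).
pose pXY : {RV P >-> (measurableTypeR R * measurableTypeR R)%type} :=
  HB.pack (fun w => (X w, Y w)) (isMeasurableFun.Build _ _ _ _ _ mXY).
pose mu := (distribution P pX \x distribution P pY)%E.
have muE A : measurable A -> mu A = distribution P pXY A.
  by move=> mA; apply: product_measure_unique => // B C mB mC; exact: indXY.
pose f (z : measurableTypeR R * measurableTypeR R) := (z.1 * z.2)%:E.
have mf : measurable_fun [set: _] f by apply/measurable_EFinP/measurable_funM.
have mid : measurable_fun [set: measurableTypeR R] (EFin : R -> \bar R).
  exact: EFin_measurable.
have iidX : (distribution P pX).-integrable setT (EFin : R -> \bar R).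
  by apply: integrable_pushforward.
have iidY : (distribution P pY).-integrable setT (EFin : R -> \bar R).
  by apply: integrable_pushforward.
(* By Tonelli the absolute integral is the product of the two absolute moments, both finite. *)
have imu : mu.-integrable setT f.
  apply/integrable12ltyP => //=.
  under eq_integral => x _.
    under eq_integral => y _ do rewrite /f/= normrM EFinM.
    rewrite ge0_integralZl_EFin//; last exact: measurableT_comp.
    over.
  have /integrableP[_ Xoo] := iidX; have /integrableP[_ Yoo] := iidY.
  rewrite ge0_integralZr//; last 2 first.
  - exact: measurableT_comp.
  - exact: integral_ge0.
  by rewrite lte_mul_pinfty// ?integral_ge0// ge0_fin_numE// integral_ge0.
have iXY : P.-integrable setT (f \o pXY).
  apply/integrableP; split; first exact: measurableT_comp.
  rewrite -(ge0_integral_distribution pXY (f := abse \o f)); last 2 first.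
  - exact: measurableT_comp.
  - by move=> z; exact: abse_ge0.
  rewrite (eq_measure_integral mu); first by case/integrableP: imu.
  by move=> A mA _; exact/esym/muE.
split; first exact: iXY.
transitivity (\int[distribution P pXY]_z f z)%E.
  by rewrite integral_distribution.
rewrite (eq_measure_integral mu); last by move=> A mA _; exact/esym/muE.
rewrite -integral12_prod_meas1//=.
under eq_integral => x _.
  rewrite /fubini_F/f/=.
  under eq_integral do rewrite EFinM.
  rewrite integralZl// integral_distribution//= EY.
  over.
by rewrite integralZr// integral_distribution//= EX -EFinM.
Qed.

End has_mean.

Lemma mutually_independent_pair {R : realType} dO (Omega : measurableType dO)
    (P : probability Omega R) dT (T : measurableType dT) K
    (X : 'I_K -> {RV P >-> T}) (j k : 'I_K) (A B : set T) :
  mutually_independent X -> j != k -> measurable A -> measurable B ->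
  P (X j @^-1` A `&` X k @^-1` B) = (P (X j @^-1` A) * P (X k @^-1` B))%E.
Proof.
move=> indX jk mA mB.
pose C l := if l == j then A else if l == k then B else setT.
have mC l : measurable (C l) by rewrite /C; case: ifPn => // _; case: ifPn.
have Cj : C j = A by rewrite /C eqxx.
have Ck : C k = B by rewrite /C eq_sym (negbTE jk) eqxx.
have := indX C mC; rewrite (bigD1 j)// (bigD1 k)/=; last by rewrite eq_sym.
rewrite big1 ?mule1 => [|l /andP[lj lk]]; last first.
  by rewrite /C (negbTE lj) (negbTE lk) preimage_setT probability_setT.
rewrite Cj Ck => <-; congr (P _); apply/seteqP; split => [w [Aw Bw] l _ /=|w CXw].
  by rewrite /C; case: ifPn => [/eqP->//|_]; case: ifPn => [/eqP->|].
by split; [rewrite -Cj; exact: CXw|rewrite -Ck; exact: CXw].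
Qed.

(** * Mean, variance and squared error of an average of independent copies *)

Section iid_average.
Context {R : realType} d (T : measurableType d) (m : {measure set T -> \bar R}).
Context (D : set T) (p : T -> R).
Context dO (Omega : measurableType dO) (P : probability Omega R) (K : nat).
Context (X : 'I_K -> {RV P >-> T}).
Hypotheses (mD : measurable D) (mp : measurable_fun D p).
Hypothesis (p0 : forall x, D x -> 0 <= p x).
Hypothesis XD : forall k w, D (X k w).
Hypothesis lawX : forall k B, measurable B ->
  distribution P (X k) B = (\int[m]_(x in D `&` B) (p x)%:E)%E.
Hypothesis indX : mutually_independent X.
Context (F : T -> R) (a : R).
Hypothesis mF : measurable_fun D F.
Hypothesis ipF : m.-integrable D (fun x => (p x * F x)%:E).
Hypothesis EpF : (\int[m]_(x in D) (p x * F x)%:E = a%:E)%E.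
Hypothesis K0 : (0 < K)%N.

Definition average w := K%:R^-1 * \sum_(k < K) F (X k w).

(** Expressed through the density, the variance depends neither on the sample space nor on the index
    of the copy, so that different samples can be compared. It is extended-valued because it may be
    infinite. *)
Definition law_variance := (\int[m]_(x in D) (p x * (F x - a) ^+ 2)%:E)%E.

Lemma law_variance_ge0 : (0 <= law_variance)%E.
Proof.
by apply: integral_ge0 => x Dx; rewrite lee_fin mulr_ge0 ?sqr_ge0 ?p0.
Qed.

Lemma has_mean_iid k : has_integral P setT (fun w => F (X k w)) a.
Proof.
split; first exact: (integrable_law mD mp p0 (XD k) (lawX k)).
by rewrite (integral_law mD mp p0 (XD k) (lawX k)).
Qed.

Lemma has_mean_average : has_integral P setT average a.
Proof.
have := has_integralZ measurableT K%:R^-1 (has_integral_sum measurableT (index_enum 'I_K) (Q := xpredT) (fun k _ => has_mean_iid k)).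
by rewrite sumr_const card_ord -[a *+ K]mulr_natl mulrA mulVf ?mul1r// pnatr_eq0 -lt0n.
Qed.

Lemma variance_iid k : 'V_P[fun w => F (X k w)]%E = law_variance.
Proof.
rewrite /variance unlock (has_mean_expectation (has_mean_iid k))/= unlock.
rewrite /law_variance -(integral_law mD mp p0 (XD k) (lawX k)); last first.
  exact/measurable_funX/measurable_funB.
by apply: eq_integral => w _; rewrite expr2.
Qed.

(* The centered variables [F (X k w) - a] are pairwise uncorrelated, so that only
   the [K] diagonal terms of the expanded square contribute to the variance. *)
Lemma has_mean_average_sqr_error c : (law_variance < +oo)%E ->
  has_integral P setT (fun w => (average w - c) ^+ 2)
    (K%:R^-1 * fine law_variance + (a - c) ^+ 2).
Proof.
move=> Voo; set V := fine law_variance.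
have VE : law_variance = V%:E.
  by rewrite fineK// ge0_fin_numE// law_variance_ge0.
pose W k w := F (X k w) - a.
have W0 k : has_integral P setT (W k) 0.
  by have := has_integralD measurableT (has_mean_iid k) (has_mean_cst P (- a)); rewrite subrr.
have mFa : measurable_fun D (fun x => F x - a) by exact: measurable_funB.
have mFa2 : measurable_fun D (fun x => (F x - a) ^+ 2) by exact: measurable_funX.
have ipF2 : m.-integrable D (fun x => (p x * (F x - a) ^+ 2)%:E).
  apply/integrableP; split; first exact/measurable_EFinP/measurable_funM.
  under eq_integral => x /[!inE] Dx.
    rewrite gee0_abs; last by rewrite lee_fin mulr_ge0 ?sqr_ge0 ?p0.
    over.
  exact: Voo.
have WW j k : has_integral P setT (fun w => W j w * W k w) (if j == k then V else 0).
  have [<-|jk] := eqVneq j k.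
    rewrite (_ : (fun _ => _) = fun w => (F (X j w) - a) ^+ 2); last first.
      by apply/funext => w; rewrite -expr2.
    split; first exact: (integrable_law mD mp p0 (XD j) (lawX j) (F := fun x => (F x - a) ^+ 2)).
    by rewrite (integral_law mD mp p0 (XD j) (lawX j) (F := fun x => (F x - a) ^+ 2)).
  rewrite -[0](mulr0 0); apply: has_meanM_independent => // A B mA mB.
  (* [F] is measurable on [D] only; intersecting with [D], which costs nothing along [X], makes
     these sets measurable, so that independence of the [X k] applies to them. *)
  have preW l C : W l @^-1` C = X l @^-1` (D `&` (fun x => F x - a) @^-1` C).
    by apply/seteqP; split => w /=; [split => //; exact: XD|case].
  rewrite !preW; apply: mutually_independent_pair => //.
  - exact: (mFa mD A mA).
  - exact: (mFa mD B mB).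
have KV : \sum_(j < K) \sum_(k < K) (if j == k then V else 0) = K%:R * V.
  under eq_bigr => j _ do rewrite -big_mkcond/= (big_pred1 j)//.
  by rewrite sumr_const card_ord mulr_natl.
have SW := has_integral_sum measurableT (index_enum 'I_K) (Q := xpredT) (fun j _ =>
  has_integral_sum measurableT (index_enum 'I_K) (Q := xpredT) (fun k _ => WW j k)).
have SL := has_integral_sum measurableT (index_enum 'I_K) (Q := xpredT) (fun k _ => W0 k).
(* The three terms of the square of [K%:R^-1 * \sum_k W k + (a - c)]; the cross term integrates to
   zero. *)
have := has_integralD measurableT (has_integralD measurableT (has_integralZ measurableT (K%:R^-1 ^+ 2) SW)
  (has_integralZ measurableT (K%:R^-1 * (a - c) *+ 2) SL)) (has_mean_cst P ((a - c) ^+ 2)).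
have KN0 : K%:R != 0 :> R by rewrite pnatr_eq0 -lt0n.
rewrite KV big1 ?mulr0 ?addr0// mulrA expr2 -(mulrA K%:R^-1) mulVf// mulr1.
congr (has_integral _ _ _ _); apply/funext => w /=.
have -> : average w - c = K%:R^-1 * (\sum_(k < K) W k w) + (a - c).
  rewrite /average /W sumrB sumr_const card_ord mulrBr -[a *+ K]mulr_natl mulKf//.
  by rewrite addrA subrK.
have -> : \sum_(j < K) \sum_(k < K) W j w * W k w = (\sum_(k < K) W k w) ^+ 2.
  by rewrite expr2 mulr_suml; apply: eq_bigr => j _; rewrite mulr_sumr.
by rewrite [in RHS]sqrrD [in RHS]exprMn mulrnAl (mulrAC K%:R^-1 (a - c)).
Qed.

(** With the mean [a] as centre, the bias term of the squared error vanishes and only the variance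
    is left. *)
Lemma variance_average : (law_variance < +oo)%E ->
  'V_P[average]%E = ((K%:R^-1)%:E * law_variance)%E.
Proof.
move=> Voo; have := has_mean_average_sqr_error a Voo.
rewrite subrr expr0n addr0 => /has_mean_expectation.
rewrite EFinM fineK ?ge0_fin_numE ?law_variance_ge0// => <-.
rewrite /variance unlock (has_mean_expectation has_mean_average)/=.
by congr expectation; apply/funext => w /=; rewrite expr2.
Qed.

End iid_average.

(** * Derivatives at a minimum, through a logarithm and of a product *)

Section calculus.
Context {R : realType} {V : normedModType R}.
Implicit Types (f h : V -> R) (x v : V).

(** The difference quotient is nonpositive for [t < 0] and nonnegative for [t > 0], and both
    one-sided limits equal the derivative. *)
Lemma derive_global_min f x v : derivable f x v ->
  (forall y, f x <= f y) -> 'D_v f x = 0.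
Proof.
move=> dfx fmin.
pose q := fun t : R => t^-1 *: ((f \o shift x) (t *: v) - f x).
have cq : q @ 0^' --> 'D_v f x by exact: dfx.
apply/eqP; rewrite eq_le; apply/andP; split.
- have : q @ 0^'- --> 'D_v f x.
    apply: cvg_trans cq; apply: cvg_app.
    by move=> A [e e0 eA]; exists e => // y ye y0; apply: eA => //; exact/ltr0_neq0.
  move=> cl; rewrite -(cvg_lim _ cl)//.
  apply: limr_le; first by apply/cvg_ex; exists ('D_v f x).
  near=> t; rewrite /q/= /GRing.scale/= mulr_le0_ge0//.
    by rewrite invr_le0; near: t; exact: nbhs_left_le.
  by rewrite subr_ge0.
- have : q @ 0^'+ --> 'D_v f x.
    apply: cvg_trans cq; apply: cvg_app.
    by move=> A [e e0 eA]; exists e => // y ye y0; apply: eA => //; exact/lt0r_neq0.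
  move=> cl; rewrite -(cvg_lim _ cl)//.
  apply: limr_ge; first by apply/cvg_ex; exists ('D_v f x).
  near=> t; rewrite /q/= /GRing.scale/= mulr_ge0//.
    by rewrite invr_ge0; near: t; exact: nbhs_right_ge.
  by rewrite subr_ge0.
Unshelve. all: by end_near. Qed.

(* Where [h x = 0], [h] is at a minimum and its derivative vanishes, so that the
   junk value of [ln] at [0] is harmless. *)
Lemma derive_ln h x v : differentiable h x -> (forall y, 0 <= h y) ->
  'D_v h x = h x * 'D_v (fun y => ln (h y)) x.
Proof.
move=> dh h0; have [hx0|hx0] := eqVneq (h x) 0.
  rewrite hx0 mul0r derive_global_min//; first exact: diff_derivable.
  by move=> y; rewrite hx0.
have hx : 0 < h x by rewrite lt_neqAle eq_sym hx0 h0.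
have dln : differentiable (@ln R) (h x).
  by apply/derivable1_diffP/ex_derive; exact: is_derive1_ln.
rewrite -[fun y => _]/(@ln R \o h) [in RHS]deriveE; last exact: differentiable_comp.
rewrite diff_comp//= diff1E// derive1E.
rewrite (@derive_val _ _ _ _ _ _ _ (is_derive1_ln hx)).
by rewrite deriveE//= /GRing.scale/= mulrCA divff// mulr1.
Qed.

(** Writing each derivative as [f i x * l i] avoids dividing by the factors: logarithmic derivatives
    add up even where some factor vanishes. *)
Lemma is_derive_prod_log I (s : seq I) (f : I -> V -> R) (l : I -> R) x v :
  (forall i, is_derive x v (f i) (f i x * l i)) ->
  is_derive x v (fun y => \prod_(i <- s) f i y)
    (\prod_(i <- s) f i x * \sum_(i <- s) l i).
Proof.
move=> df; elim: s => [|i s IH].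
  rewrite big_nil mul1r big_nil (_ : (fun y => _) = cst 1).
    exact: is_derive_cst.
  by apply/funext => y; rewrite big_nil.
rewrite (_ : (fun y => _) = f i * (fun y => \prod_(j <- s) f j y)); last first.
  by apply/funext => y; rewrite big_cons.
rewrite !big_cons; apply: is_derive_eq.
by rewrite /GRing.scale/= mulrDr addrC -!mulrA; congr (_ + _); rewrite mulrCA.
Qed.

End calculus.

(** * Measurability along trajectories and Fubini over the first action *)

Lemma measurable_fun_pair_on d (T : measurableType d) d1 (T1 : measurableType d1)
    d2 (T2 : measurableType d2) (D : set T) (f : T -> T1) (g : T -> T2) :
  measurable_fun D f -> measurable_fun D g ->
  measurable_fun D (fun x => (f x, g x)).
Proof.
move=> mf mg /[dup] mD; apply: measurability.
  exact: measurable_prod_measurableType.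
move=> _ [_ [A mA [B mB <-]] <-].
rewrite (_ : _ `&` _ = (D `&` f @^-1` A) `&` (D `&` g @^-1` B)); last first.
  by apply/seteqP; split => x /=; tauto.
by apply: measurableI; [exact: mf|exact: mg].
Qed.

Section trajectories.
Context {R : realType} {ds da : nat} (M : mdp R ds da).
Hypothesis Mwf : mdp_wf M.
Local Notation state := (euclidean R ds).
Local Notation action := (euclidean R da).
Local Notation traj n := (@trajectories R ds da M n).

Lemma states_state_at s n (u : n.-tuple action) (t : 'I_n) :
  states M s -> trajectories M u -> states M (state_at M s u t).
Proof.
move=> Ss uA; rewrite /state_at; have := ltnW (ltn_ord t).
elim: (nat_of_ord t) => [|k IH] kn; first by rewrite take0.
rewrite (take_nth (tnth u (Ordinal kn))) ?size_tuple// foldl_rcons.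
apply: (dynamics_states Mwf); first exact/IH/ltnW.
by rewrite -(tnth_nth _ u (Ordinal kn)); exact: uA.
Qed.

Lemma measurable_trajectories n :
  measurable (traj n).
Proof.
rewrite (_ : traj n = \bigcap_(t in [set: 'I_n])
    ((fun u : n.-tuple action => tnth u t) @^-1` actions M)); last first.
  by apply/seteqP; split => [u uA t _|u uA t]; exact: uA.
apply: fin_bigcap_measurable => // t _.
rewrite -[X in measurable X]setTI.
by apply: measurable_tnth => //; exact: actions_measurable Mwf.
Qed.
Local Hint Resolve measurable_trajectories : core.

Lemma measurable_fun_states_actions d (T : measurableType d) (f : state -> action -> T)
    n (D : set (n.-tuple action)) (x : n.-tuple action -> state)
    (y : n.-tuple action -> action) :
  measurable_fun (states M `*` actions M) (fun z : state * action => f z.1 z.2) ->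
  (forall u, D u -> states M (x u) /\ actions M (y u)) ->
  measurable_fun D x -> measurable_fun D y ->
  measurable_fun D (fun u => f (x u) (y u)).
Proof.
move=> mf Dxy mx my.
apply: (measurable_comp _ _ mf (measurable_fun_pair_on mx my)).
  by apply: measurableX; [exact: states_measurable|exact: actions_measurable].
by move=> _ [u Du <-]; exact: Dxy.
Qed.

Lemma measurable_state_at s n (t : 'I_n) : states M s ->
  measurable_fun (traj _) (fun u : n.-tuple action => state_at M s u t).
Proof.
move=> Ss; rewrite /state_at; have [k kt] := ex_intro (fun k => k = nat_of_ord t) _ erefl.
elim: k t kt => [|k IH] t kt.
  by rewrite -kt; under eq_fun do rewrite take0; exact: measurable_cst.
have kn : (k < n)%N by rewrite (leq_trans _ (ltn_ord t))// -kt.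
have kn' := IH (Ordinal kn) erefl.
rewrite (_ : (fun u => _) = fun u =>
    dynamics M (state_at M s u (Ordinal kn)) (tnth u (Ordinal kn))); last first.
  apply/funext => u; rewrite -kt.
  rewrite (take_nth (tnth u (Ordinal kn))) ?size_tuple// foldl_rcons.
  by rewrite -(tnth_nth _ u (Ordinal kn)).
apply: measurable_fun_states_actions => //.
- exact: dynamics_measurable.
- by move=> u uA; split; [exact: states_state_at|exact: uA].
- by apply: measurable_funTS; exact: measurable_tnth.
Qed.

Lemma measurable_along s n (t : 'I_n) (f : state -> action -> R) : states M s ->
  measurable_fun (states M `*` actions M) (fun z : state * action => f z.1 z.2) ->
  measurable_fun (traj _)
    (fun u : n.-tuple action => f (state_at M s u t) (tnth u t)).
Proof.
move=> Ss mf; apply: measurable_fun_states_actions => //.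
- by move=> u uA; split; [exact: states_state_at|exact: uA].
- exact: measurable_state_at.
- by apply: measurable_funTS; exact: measurable_tnth.
Qed.

Lemma trajectories_tcons n a (v : n.-tuple action) :
  trajectories M (tcons (a, v)) <-> actions M a /\ trajectories M v.
Proof.
split=> [avA|[Aa vA] t].
  split=> [|t]; first by have := avA ord0.
  by have := avA (lift ord0 t); rewrite tnthS.
by have [j ->|->] := unliftP ord0 t; [rewrite tnthS; exact: vA|].
Qed.

(** Removing the first action restarts the dynamics at [dynamics M s a] and shifts time by one; [h]
    is indexed by [nat] so that it can be shifted while the horizon shrinks. *)
Lemma prod_state_at_tcons s n a (v : n.-tuple action)
    (h : nat -> state -> action -> R) :
  \prod_(t < n.+1) h t (state_at M s (tcons (a, v)) t) (tnth (tcons (a, v)) t) =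
  h 0%N s a *
  \prod_(t < n) h t.+1 (state_at M (dynamics M s a) v t) (tnth v t).
Proof.
by rewrite big_ord_recl; congr (_ * _); apply: eq_bigr => t _; rewrite tnthS.
Qed.

Context (mu : {sigma_finite_measure set action -> \bar R}) (n : nat).
Implicit Types F : n.+1.-tuple action -> R.

Local Notation extend F := ((EFin \o F) \_ (traj _)).

(** The trajectory set is a product, so extension by zero can be done one action at a time. This
    links Fubini on whole spaces to integrals over [actions M] and shorter trajectories. *)
Lemma patch_tcons F a :
  (fun v : n.-tuple action => extend F (tcons (a, v))) =
  if a \in actions M then (fun v => (F (tcons (a, v)))%:E) \_ (traj _)
  else cst 0%E.
Proof.
apply/funext => v; case: ifPn => [/[!inE] Aa|]; last first.
  rewrite notin_setE => nAa; rewrite patchE memNset// => avA.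
  by apply: nAa; have [] := (trajectories_tcons a v).1 avA.
rewrite !patchE; congr (if _ then _ else _).
apply/idP/idP => /[!inE] [/trajectories_tcons[]//|vA].
by apply/trajectories_tcons.
Qed.

Lemma fubini_patch_tcons F a :
  fubini_F (power_measure mu n) (extend F \o @tcons _ _ n) a =
  ((fun a => \int[power_measure mu n]_(v in traj _) (F (tcons (a, v)))%:E)%E
     \_ (actions M)) a.
Proof.
rewrite /fubini_F/= patch_tcons patchE; case: ifPn => _; last by rewrite integral0.
by rewrite -integral_mkcond.
Qed.

Lemma ge0_integral_trajectories F : measurable_fun (traj _) F ->
  (forall u, trajectories M u -> 0 <= F u) ->
  (\int[power_measure mu n.+1]_(u in traj _) (F u)%:E =
   \int[mu]_(a in actions M)
     \int[power_measure mu n]_(v in traj _) (F (tcons (a, v)))%:E)%E.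
Proof.
move=> mF F0.
have mFt : measurable_fun setT (extend F).
  apply/(measurable_restrictT _ (@measurable_trajectories n.+1)).
  exact/measurable_EFinP.
have Ft0 u : (0 <= extend F u)%E.
  by rewrite patchE; case: ifPn => // /[!inE] /F0; rewrite lee_fin.
rewrite integral_mkcond.
transitivity (\int[(mu \x power_measure mu n)]_x (extend F \o @tcons _ _ n) x)%E.
  apply: (ge0_integral_pushforward (@measurable_tcons _ _ _) _ measurableT mFt).
  by move=> u _; exact: Ft0.
rewrite (fubini_tonelli1 (extend F \o @tcons _ _ n)); last 2 first.
- by apply: measurableT_comp; [exact: mFt|exact: measurable_tcons].
- by move=> x; exact: Ft0.
by rewrite [RHS]integral_mkcond; apply: eq_integral => a _; exact: fubini_patch_tcons.
Qed.

Section integrable.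
Variable F : n.+1.-tuple action -> R.
Hypothesis iF : (power_measure mu n.+1).-integrable (traj _) (EFin \o F).

Let mFt : measurable_fun setT (extend F).
Proof.
apply/(measurable_restrictT _ (@measurable_trajectories n.+1)).
exact: measurable_int iF.
Qed.

Let integrable_patch_tcons :
  (mu \x power_measure mu n)%E.-integrable setT (extend F \o @tcons _ _ n).
Proof.
apply/integrableP; split.
  by apply: measurableT_comp; [exact: mFt|exact: measurable_tcons].
have /integrableP[_] := (integrable_mkcond _ (@measurable_trajectories n.+1)).1 iF.
apply: le_lt_trans.
rewrite le_eqVlt; apply/orP; left; apply/eqP; symmetry.
rewrite -(ge0_integral_pushforward (@measurable_tcons _ _ _) _ measurableT (f := abse \o extend F))//.
  exact: measurableT_comp.
by move=> u _; exact: abse_ge0.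
Qed.

(** Fubini controls almost every section only, and the induction on the horizon needs integrability
    of the sections to continue. *)
Lemma ae_integrable_trajectories :
  {ae mu, forall a, actions M a -> (power_measure mu n).-integrable (traj _)
    (fun v => (F (tcons (a, v)))%:E)}.
Proof.
have := ae_integrable1 integrable_patch_tcons.
apply: filterS => a /= + Aa; rewrite patch_tcons mem_set// => ia.
by apply/(integrable_mkcond _ (@measurable_trajectories n)).
Qed.

Lemma measurable_integral_trajectories :
  measurable_fun (actions M)
    (fun a => \int[power_measure mu n]_(v in traj _) (F (tcons (a, v)))%:E)%E.
Proof.
apply/(measurable_restrictT _ (actions_measurable Mwf)).
have := measurable_fubini_F integrable_patch_tcons.
by congr measurable_fun; apply/funext => a; exact: fubini_patch_tcons.
Qed.

Lemma integral_trajectories :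
  (\int[power_measure mu n.+1]_(u in traj _) (F u)%:E =
   \int[mu]_(a in actions M)
     \int[power_measure mu n]_(v in traj _) (F (tcons (a, v)))%:E)%E.
Proof.
rewrite integral_mkcond.
transitivity (\int[(mu \x power_measure mu n)]_x (extend F \o @tcons _ _ n) x)%E.
  rewrite -[RHS](integral_pushforward (@measurable_tcons _ _ _) mFt _ measurableT)//.
rewrite -integral12_prod_meas1//.
by rewrite [RHS]integral_mkcond; apply: eq_integral => a _; exact: fubini_patch_tcons.
Qed.

End integrable.

End trajectories.

(** * The trajectory density and the vanishing mean of the score *)

Section policy.
Context {R : realType} {ds da d : nat} (M : mdp R ds da).
Local Notation state := (euclidean R ds).
Local Notation action := (euclidean R da).
Local Notation traj n := (@trajectories R ds da M n).
Context (mu : {sigma_finite_measure set action -> \bar R}).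
Context (pi : 'rV[R]_d -> state -> action -> R) (theta : 'rV[R]_d).
Hypothesis Mwf : mdp_wf M.
Hypothesis piP : is_policy M mu pi.
Hypothesis piR : policy_regular M mu pi theta.
Local Notation density s n := (@trajectory_density R ds da d M s pi n theta).
Local Notation Dpi i s a := ('D_('e_i) (fun theta' => pi theta' s a) theta).

Lemma trajectory_density_ge0 s n (u : n.-tuple action) :
  states M s -> traj n u -> 0 <= density s n u.
Proof.
move=> Ss uA; apply: prodr_ge0 => t _.
by apply: (policy_ge0 piP); [exact: states_state_at|exact: uA].
Qed.

Lemma measurable_trajectory_density s n : states M s ->
  measurable_fun (traj n) (density s n).
Proof.
move=> Ss; apply: measurable_prod => t _.
by apply: measurable_along => //; exact: policy_measurable piP theta.
Qed.

Lemma trajectory_density_tcons s n a (v : n.-tuple action) :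
  density s n.+1 (tcons (a, v)) =
  pi theta s a * density (dynamics M s a) n v.
Proof. exact: (prod_state_at_tcons M s a v (fun _ => pi theta)). Qed.

Lemma integral_trajectory_density s n : states M s ->
  (\int[power_measure mu n]_(u in traj n) (density s n u)%:E = 1)%E.
Proof.
elim: n s => [|n IH] s Ss.
  (* At horizon zero the measure is a point mass at the empty tuple, where the density is an empty
     product. *)
  rewrite integral_dirac//; first last.
  - by apply/measurable_EFinP; exact: measurable_trajectory_density.
  - exact: measurable_trajectories.
  by rewrite diracE mem_set ?mul1e ?/trajectory_density ?big_ord0// => -[].
rewrite ge0_integral_trajectories//; last 2 first.
- exact: measurable_trajectory_density.
- by move=> u; exact: trajectory_density_ge0.
rewrite -[RHS](policy_total piP theta Ss); apply: eq_integral => a /[!inE] Aa.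
have Ssa : states M (dynamics M s a) by exact: (dynamics_states Mwf).
under eq_integral do rewrite trajectory_density_tcons EFinM.
rewrite ge0_integralZl_EFin ?IH ?mule1//.
- exact: measurable_trajectories.
- by move=> v vA; rewrite lee_fin trajectory_density_ge0.
- by apply/measurable_EFinP; exact: measurable_trajectory_density.
- exact: (policy_ge0 piP).
Qed.

(** Nonnegativity for every parameter is what makes this hold also where the policy vanishes,
    through [derive_ln]. *)
Lemma policyM_score s a i : states M s -> actions M a ->
  pi theta s a * score pi theta s a 0 i = Dpi i s a.
Proof.
move=> Ss Aa; rewrite /score /grad mxE -(derive_ln (h := fun t => pi t s a))//.
  exact: (policy_differentiable piP).
by move=> t; exact: (policy_ge0 piP).
Qed.

Lemma integral_policy_derivative i s : states M s ->
  (\int[mu]_(a in actions M) (Dpi i s a)%:E = 0)%E.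
Proof.
move=> Ss; have iD := policy_derivative_integrable piR i Ss.
have [_ /esym] := policy_interchange piR i Ss.
rewrite (_ : (fun theta' => \int[mu]_(a in _) pi theta' s a) = cst 1); last first.
  by apply/funext => t; rewrite /Rintegral (policy_total piP).
rewrite derive_cst /Rintegral => D0.
(* The interchange is about real-valued integrals; integrability makes the extended integral finite,
   hence determined by its real part. *)
rewrite -[LHS]fineK ?D0//; apply: integrable_fin_num => //.
exact: (actions_measurable Mwf).
Qed.

(* Integrating first over the actions taken after time [t], whose conditional
   densities have total mass one, and then over the one at time [t] leaves the
   derivative of a constant. *)
Lemma integral_score_factor i n (h : nat -> state -> action -> R) s t :
  states M s -> (t < n)%N ->
  (forall s a, states M s -> actions M a -> h t s a = Dpi i s a) ->
  (forall j s a, (t < j)%N -> states M s -> actions M a -> h j s a = pi theta s a) ->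
  (power_measure mu n).-integrable (traj n)
    (fun u => (\prod_(j < n) h j (state_at M s u j) (tnth u j))%:E) ->
  (\int[power_measure mu n]_(u in traj n)
    (\prod_(j < n) h j (state_at M s u j) (tnth u j))%:E = 0)%E.
Proof.
elim: n h s t => [//|n IH] h s t Ss tn ht hj ih.
rewrite (integral_trajectories Mwf ih).
have mA := actions_measurable Mwf.
case: t => [|t] in tn ht hj *.
  rewrite -(integral_policy_derivative i Ss); apply: eq_integral => a /[!inE] Aa.
  have Ssa : states M (dynamics M s a) by exact: (dynamics_states Mwf).
  transitivity (\int[power_measure mu n]_(v in traj n)
      ((Dpi i s a)%:E * (density (dynamics M s a) n v)%:E))%E.
    apply: eq_integral => v /[!inE] vA.
    rewrite prod_state_at_tcons ht// EFinM; congr (_ * _%:E)%E.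
    apply: eq_bigr => j _; apply: hj => //.
    exact: states_state_at.
  rewrite integralZl ?integral_trajectory_density ?mule1//.
    exact: measurable_trajectories.
  apply/integrableP; split.
    by apply/measurable_EFinP; exact: measurable_trajectory_density.
  under eq_integral => v /[!inE] vA.
    rewrite gee0_abs ?lee_fin ?trajectory_density_ge0//.
    over.
  by rewrite integral_trajectory_density// ltry.
(* The score sits at a later time: the inner integral vanishes for almost every first action,
   whatever the first factor is. *)
transitivity (\int[mu]_(a in actions M) (cst 0 a))%E; last by rewrite integral0.
apply: ae_eq_integral => //.
  exact: (measurable_integral_trajectories Mwf ih).
have := ae_integrable_trajectories Mwf ih.
apply: filterS => a /= ia Aa.
have Ssa : states M (dynamics M s a) by exact: (dynamics_states Mwf).
(* Integrability of the remaining product is obtained by dividing by the first factor; if that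
   factor is zero, the whole integrand is zero. *)
have [h0|h0] := eqVneq (h 0%N s a) 0.
  under eq_integral do rewrite prod_state_at_tcons h0 mul0r.
  by rewrite integral0.
have mtr : measurable (traj n) by exact: measurable_trajectories.
have ih' : (power_measure mu n).-integrable (traj n) (fun v =>
    (\prod_(j < n) h j.+1 (state_at M (dynamics M s a) v j) (tnth v j))%:E).
  have := integrableZl mtr (h 0%N s a)^-1 (ia Aa).
  apply: eq_integrable => // v _.
  by rewrite prod_state_at_tcons -EFinM mulKf.
under eq_integral do rewrite prod_state_at_tcons EFinM.
rewrite integralZl//.
by rewrite (IH (fun j => h j.+1) _ t)// ?mule0// => j *; exact: hj.
Qed.

(** For fixed actions the states do not depend on [theta], so only the policy factors are
    differentiated. *)
Lemma is_derive_trajectory_density s n (u : n.-tuple action) i :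
  states M s -> traj n u ->
  is_derive theta 'e_i
    ((@trajectory_density R ds da d M s pi n)^~ u)
    (density s n u * \sum_(t < n) score pi theta (state_at M s u t) (tnth u t) 0 i).
Proof.
move=> Ss uA; apply: (is_derive_prod_log (index_enum 'I_n)) => t.
have Sst : states M (state_at M s u t) by exact: states_state_at.
rewrite policyM_score//; apply: derivableP; apply: diff_derivable.
exact: (policy_differentiable piP).
Qed.

End policy.

(** * Correlations of scores and rewards, and the policy gradient *)

Section reinforce.
Context {R : realType} {ds da d : nat} (M : mdp R ds da).
Local Notation state := (euclidean R ds).
Local Notation action := (euclidean R da).
Context (mu : {sigma_finite_measure set action -> \bar R}).
Context (pi : 'rV[R]_d -> state -> action -> R) (theta : 'rV[R]_d).
Context (s0 : state) (H : nat).
Hypothesis Mwf : mdp_wf M.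
Hypothesis piP : is_policy M mu pi.
Hypothesis piR : policy_regular M mu pi theta.
Hypothesis Ss0 : states M s0.
Local Notation traj := (@trajectories R ds da M H).
Local Notation P := (power_measure mu H).
Local Notation density := (@trajectory_density R ds da d M s0 pi H theta).
Local Notation score_at u t i := (score pi theta (state_at M s0 u t) (tnth u t) 0 i).
Local Notation along rho u t := (rho (state_at M s0 u t) (tnth u t)).

Let mtraj : measurable traj. Proof. exact: measurable_trajectories. Qed.

Lemma reinforceE u i : reinforce M s0 pi theta u 0 i =
  \sum_(t < H) discount M ^+ t * reward_to_go M s0 u t * score_at u t i.
Proof. by rewrite /reinforce summxE; apply: eq_bigr => t _; rewrite mxE. Qed.

Lemma measurable_reinforce i :
  measurable_fun traj (fun u => reinforce M s0 pi theta u 0 i).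
Proof.
under eq_fun do rewrite reinforceE.
apply: measurable_sum => t; apply: measurable_funM.
  apply: measurable_funM => //; rewrite /reward_to_go.
  under eq_fun do rewrite big_mkcond/=.
  apply: measurable_sum => t'; case: (t <= t')%N => //.
  apply: measurable_funM => //; apply: measurable_along => //.
  exact: reward_measurable.
apply: (@measurable_along _ _ _ _ Mwf _ _ t (fun s a => score pi theta s a 0 i)) => //.
exact: (score_measurable piR).
Qed.

Section reward.
Variable rho : state -> action -> R.
Hypothesis rhoR : reward_regular M s0 mu pi H rho theta.

(** The gradient of the return and the mean of the estimator are both linear combinations of these
    correlations, which allows a comparison term by term. *)
Definition score_reward i (t t' : 'I_H) : R :=
  \int[P]_(u in traj) (density u * (score_at u t i * along rho u t')).

Lemma has_integral_score_reward i t t' :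
  has_integral P traj (fun u => density u * (score_at u t i * along rho u t'))
    (score_reward i t t').
Proof.
by apply: integrable_has_integral => //; exact: score_reward_integrable rhoR i t t'.
Qed.

(* The score at time [t] has mean zero given the past, hence is uncorrelated with
   the rewards received before [t]. *)
Lemma score_reward_past i (t t' : 'I_H) : (t' < t)%N -> score_reward i t t' = 0.
Proof.
move=> tt'.
(* The score is inserted at time [t] and the reward at time [t'], which turns the integrand into a
   product of one factor per time step. *)
pose h (j : nat) s a := pi theta s a *
  ((if j == t then score pi theta s a 0 i else 1) * (if j == t' then rho s a else 1)).
have hE u : density u * (score_at u t i * along rho u t') =
    \prod_(j < H) h j (state_at M s0 u j) (tnth u j).
  rewrite /h big_split/= big_split/=; congr (_ * (_ * _)).
    by rewrite -big_mkcond/= (big_pred1 t).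
  by rewrite -big_mkcond/= (big_pred1 t').
rewrite /score_reward /Rintegral; under eq_integral do rewrite hE.
rewrite (integral_score_factor Mwf piP piR (i := i) (t := t))//.
- move=> s a Ss Aa; rewrite /h eqxx gtn_eqF// mulr1.
  exact: (policyM_score theta piP).
- move=> j s a tj Ss Aa; rewrite /h gtn_eqF// gtn_eqF ?mulr1//.
  exact: ltn_trans tj.
have := score_reward_integrable rhoR i t t'.
by under eq_fun do rewrite hE.
Qed.

(** The derivative of the density brings in the sum of all scores, so every score meets every
    reward, past rewards included. *)
Lemma has_integral_derive_return i :
  has_integral P traj
    (fun u => 'D_('e_i) ((@trajectory_density R ds da d M s0 pi H)^~ u) theta *
      discounted_sum M s0 rho u)
    (\sum_(t < H) \sum_(t' < H) discount M ^+ t' * score_reward i t t').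
Proof.
apply: (eq_has_integral mtraj); last first.
  apply: (has_integral_sum mtraj (index_enum 'I_H) (Q := xpredT)) => t _.
  apply: (has_integral_sum mtraj (index_enum 'I_H) (Q := xpredT)) => t' _.
  apply: (has_integralZ mtraj (discount M ^+ t')).
  exact: has_integral_score_reward.
move=> u uA /=.
have [_ ->] := is_derive_trajectory_density theta Mwf piP i Ss0 uA.
rewrite -mulrA mulr_suml mulr_sumr; apply: eq_bigr => t _.
rewrite mulr_sumr mulr_sumr; apply: eq_bigr => t' _.
by rewrite mulrCA; congr (_ * _); rewrite mulrCA.
Qed.

Lemma grad_expected_return i : grad (expected_return M s0 mu pi H rho) theta 0 i =
  \sum_(t < H) \sum_(t' < H) discount M ^+ t' * score_reward i t t'.
Proof.
have [_ D] := return_interchange rhoR i.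
by rewrite mxE D; apply: has_integral_Rintegral; exact: has_integral_derive_return.
Qed.

End reward.

(** Once the terms with [t' < t] are dropped from the gradient, the weights match: [gamma^t] from
    the estimator times [gamma^(t' - t)] from the reward to go is [gamma^t']. *)
Lemma has_integral_reinforce i :
  reward_regular M s0 mu pi H (reward M) theta ->
  has_integral P traj (fun u => density u * reinforce M s0 pi theta u 0 i)
    (grad (J M s0 mu pi H) theta 0 i).
Proof.
move=> rR; rewrite /J (grad_expected_return rR).
rewrite (_ : \sum_(t < H) _ = \sum_(t < H) \sum_(t' < H | (t <= t')%N)
    discount M ^+ t' * score_reward (reward M) i t t'); last first.
  apply: eq_bigr => t _; rewrite [RHS]big_mkcond; apply: eq_bigr => t' _.
  by case: leqP => // tt'; rewrite (score_reward_past rR)// mulr0.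
apply: (eq_has_integral mtraj); last first.
  apply: (has_integral_sum mtraj (index_enum 'I_H) (Q := xpredT)) => t _.
  apply: (has_integral_sum mtraj (index_enum 'I_H) (Q := fun t' => (t <= t')%N)) => t' _.
  apply: (has_integralZ mtraj (discount M ^+ t')).
  exact: (has_integral_score_reward rR).
move=> u uA /=; rewrite reinforceE mulr_sumr; apply: eq_bigr => t _.
rewrite /reward_to_go mulr_sumr mulr_suml mulr_sumr; apply: eq_bigr => t' tt'.
rewrite -{1}(subnKC tt') exprD.
set x := score_at u t i; set y := reward _ _ _.
by rewrite (mulrCA _ (density u)) -!mulrA (mulrC x).
Qed.

(** The equality is between functions of the parameter, since it will be differentiated at [theta];
    hence integrability at every [theta']. *)
Lemma expected_returnD rho1 rho2 :
  reward_regular M s0 mu pi H rho1 theta -> reward_regular M s0 mu pi H rho2 theta ->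
  expected_return M s0 mu pi H (fun s a => rho1 s a + rho2 s a) =
  expected_return M s0 mu pi H rho1 + expected_return M s0 mu pi H rho2.
Proof.
move=> r1 r2; apply/funext => theta'.
have int rho : reward_regular M s0 mu pi H rho theta ->
    P.-integrable traj (EFin \o fun u =>
      trajectory_density M s0 pi theta' u * discounted_sum M s0 rho u).
  move=> rR.
  have [+ _] := has_integral_sum mtraj (index_enum 'I_H) (Q := xpredT) (fun t _ =>
    has_integralZ mtraj (discount M ^+ t)
      (integrable_has_integral mtraj (reward_integrable rR theta' t))).
  apply: eq_integrable => // u _ /=; congr EFin.
  by rewrite mulr_sumr; apply: eq_bigr => t _; rewrite mulrCA.
rewrite /expected_return /trajectory_expectation -[RHS]RintegralD//; try exact: int.
apply: eq_Rintegral => u _; rewrite -mulrDr -big_split/=; congr (_ * _).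
by apply: eq_bigr => t _; rewrite mulrDr.
Qed.

Lemma derivable_expected_return rho i : reward_regular M s0 mu pi H rho theta ->
  derivable (expected_return M s0 mu pi H rho) theta 'e_i.
Proof. by move=> rR; have [] := return_interchange rR i. Qed.

Lemma grad_expected_returnD rho1 rho2 :
  reward_regular M s0 mu pi H rho1 theta -> reward_regular M s0 mu pi H rho2 theta ->
  grad (expected_return M s0 mu pi H (fun s a => rho1 s a + rho2 s a)) theta =
  grad (expected_return M s0 mu pi H rho1) theta +
  grad (expected_return M s0 mu pi H rho2) theta.
Proof.
move=> r1 r2; apply/rowP => i; rewrite !mxE expected_returnD//.
by apply: deriveD; exact: derivable_expected_return.
Qed.

(** Regularity is assumed for the true reward and for the bias separately; this hands it to the
    biased reward, from which the estimator is computed. *)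
Lemma reward_regularD rho1 rho2 :
  reward_regular M s0 mu pi H rho1 theta -> reward_regular M s0 mu pi H rho2 theta ->
  reward_regular M s0 mu pi H (fun s a => rho1 s a + rho2 s a) theta.
Proof.
move=> r1 r2; split.
- move=> theta' t.
  have := integrableD mtraj (reward_integrable r1 theta' t) (reward_integrable r2 theta' t).
  by apply: eq_integrable => // u _; rewrite -EFinD mulrDr.
- move=> i t t'.
  have := integrableD mtraj (score_reward_integrable r1 i t t')
    (score_reward_integrable r2 i t t').
  by apply: eq_integrable => // u _; rewrite -EFinD -mulrDr -mulrDr.
- move=> i; rewrite expected_returnD//.
  split.
    by apply: derivableD; exact: derivable_expected_return.
  rewrite deriveD; try exact: derivable_expected_return.
  have [_ ->] := return_interchange r1 i; have [_ ->] := return_interchange r2 i.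
  have [i1 _] := has_integral_derive_return r1 i.
  have [i2 _] := has_integral_derive_return r2 i.
  rewrite -RintegralD//; apply: eq_Rintegral => u _; rewrite -mulrDr.
  by rewrite -big_split/=; congr (_ * _); apply: eq_bigr => t _; rewrite mulrDr.
Qed.

End reinforce.

(** * The averaged estimator: mean, total variance and squared error *)

Section sampling.
Context {R : realType} {ds da d : nat} (M : mdp R ds da).
Local Notation state := (euclidean R ds).
Local Notation action := (euclidean R da).
Context (mu : {sigma_finite_measure set action -> \bar R}).
Context (pi : 'rV[R]_d -> state -> action -> R) (theta : 'rV[R]_d).
Context (s0 : state) (H : nat).
Hypothesis Mwf : mdp_wf M.
Hypothesis piP : is_policy M mu pi.
Hypothesis piR : policy_regular M mu pi theta.
Hypothesis Ss0 : states M s0.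
Hypothesis rR : reward_regular M s0 mu pi H (reward M) theta.
Local Notation traj := (@trajectories R ds da M H).
Local Notation density := (@trajectory_density R ds da d M s0 pi H theta).
Local Notation F i := (fun u : H.-tuple action => reinforce M s0 pi theta u 0 i).
Local Notation g i := (grad (J M s0 mu pi H) theta 0 i).

Definition reinforce_variance i : \bar R :=
  law_variance (power_measure mu H) traj density (F i) (g i).

Lemma reinforce_variance_ge0 i : (0 <= reinforce_variance i)%E.
Proof. by apply: law_variance_ge0 => u; exact: (trajectory_density_ge0 theta Mwf piP). Qed.

Context dO (Omega : measurableType dO) (P : probability Omega R) (K : nat).
Context (tau : 'I_K -> {RV P >-> H.-tuple action}).
Hypothesis K0 : (0 < K)%N.
Hypothesis tauP : iid_trajectories M s0 mu pi theta tau.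
Local Notation ghat := (averaged_reinforce M s0 pi theta tau).

Lemma averaged_reinforceE i : (fun w => ghat w 0 i) = average tau (F i).
Proof. by apply/funext => w; rewrite /averaged_reinforce mxE summxE. Qed.

Let mtraj : measurable traj. Proof. exact: measurable_trajectories. Qed.
Let mdensity : measurable_fun traj density.
Proof. by apply: (measurable_trajectory_density theta Mwf piP). Qed.
Let density0 u : traj u -> 0 <= density u.
Proof. exact: (trajectory_density_ge0 theta Mwf piP). Qed.
Let valP k w : traj (tau k w). Proof. exact: (iid_values tauP). Qed.
Let lawP k B : measurable B -> distribution P (tau k) B =
  (\int[power_measure mu H]_(u in traj `&` B) (density u)%:E)%E.
Proof. exact: (iid_law tauP). Qed.
Let indP : mutually_independent tau. Proof. exact: (iid_independent tauP). Qed.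
Let mF i : measurable_fun traj (F i). Proof. exact: (measurable_reinforce Mwf piR). Qed.
Let iF i : has_integral (power_measure mu H) traj (fun u => density u * F i u) (g i).
Proof. exact: (has_integral_reinforce Mwf piP piR). Qed.

Lemma has_mean_averaged_reinforce i : has_integral P setT (fun w => ghat w 0 i) (g i).
Proof.
rewrite averaged_reinforceE.
exact: (has_mean_average mtraj mdensity density0 valP lawP (mF i) (iF i).1 (iF i).2).
Qed.

Lemma total_variance_reinforce k :
  total_variance P (fun w => reinforce M s0 pi theta (tau k w)) =
  (\sum_(i < d) reinforce_variance i)%E.
Proof.
apply: eq_bigr => i _.
exact: (variance_iid mtraj mdensity density0 valP lawP (mF i) (iF i).1 (iF i).2).
Qed.

Hypothesis voo : (\sum_(i < d) reinforce_variance i < +oo)%E.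

Let vioo i : (reinforce_variance i < +oo)%E.
Proof.
apply: le_lt_trans voo; rewrite (bigD1 i)//= leeDl//.
by apply: sume_ge0 => j _; exact: reinforce_variance_ge0.
Qed.

Lemma total_variance_averaged_reinforce :
  total_variance P ghat = (K%:R^-1%:E * \sum_(i < d) reinforce_variance i)%E.
Proof.
rewrite ge0_sume_distrr; last by move=> i _; exact: reinforce_variance_ge0.
apply: eq_bigr => i _; rewrite averaged_reinforceE.
exact: (variance_average mtraj mdensity density0 valP lawP indP (mF i)
  (iF i).1 (iF i).2 K0 (vioo i)).
Qed.

(** The squared Euclidean norm splits into coordinates, each covered by the scalar formula. The free
    centre [c] leaves room for a target other than the mean. *)
Lemma averaged_reinforce_sqr_error c :
  'E_P[fun w => (norm2 (ghat w - c) ^+ 2)%R]%E =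
  (K%:R^-1%:E * \sum_(i < d) reinforce_variance i +
    (norm2 (grad (J M s0 mu pi H) theta - c) ^+ 2)%:E)%E.
Proof.
have norm2E (v : 'rV[R]_d) : norm2 v ^+ 2 = \sum_(i < d) v 0 i ^+ 2.
  by rewrite sqr_sqrtr// sumr_ge0// => i _; exact: sqr_ge0.
have := has_integral_sum measurableT (index_enum 'I_d) (Q := xpredT) (fun i _ =>
  has_mean_average_sqr_error mtraj mdensity density0 valP lawP indP (mF i)
    (iF i).1 (iF i).2 K0 (c 0 i) (vioo i)).
move=> /has_mean_expectation E.
transitivity ('E_P[fun w => (\sum_(i < d) (average tau (F i) w - c 0 i) ^+ 2)%R])%E.
  congr expectation; apply/funext => w; rewrite norm2E; apply: eq_bigr => i _.
  by rewrite -averaged_reinforceE !mxE.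
rewrite E big_split/= EFinD norm2E; congr (_ + _%:E)%E; last first.
  by apply: eq_bigr => i _; rewrite !mxE.
rewrite -mulr_sumr EFinM -sumEFin; congr (_ * _)%E; apply: eq_bigr => i _.
by rewrite fineK// ge0_fin_numE// ?reinforce_variance_ge0//; exact: vioo.
Qed.

End sampling.

(** * Bias, mean squared error and the effect of more trajectories *)

Theorem proposition2 (R : realType) (ds da d : nat)
    (M : mdp R ds da) (s0 : euclidean R ds)
    (b : euclidean R ds -> euclidean R da -> R)
    (mu : {sigma_finite_measure set (euclidean R da) -> \bar R})
    (pi : 'rV[R]_d -> euclidean R ds -> euclidean R da -> R)
    (H : nat) (theta : 'rV[R]_d)
    (dO : measure_display) (Omega : measurableType dO) (P : probability Omega R)
    (K : nat) (tau : 'I_K -> {RV P >-> H.-tuple (euclidean R da)})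
    (HM : mdp_wf M) (Hs0 : states M s0)
    (Hb : measurable_fun (states M `*` actions M)
            (fun x : euclidean R ds * euclidean R da => b x.1 x.2))
    (Hpi : is_policy M mu pi)
    (Hpi_reg : policy_regular M mu pi theta)
    (Hr_reg : reward_regular M s0 mu pi H (reward M) theta)
    (Hb_reg : reward_regular M s0 mu pi H b theta)
    (HK : (0 < K)%N)
    (Htau : iid_trajectories M s0 mu pi theta tau) :
  let Mt := with_bias M b in
  let g := grad (J M s0 mu pi H) theta in
  let gradB := grad (expected_return M s0 mu pi H b) theta in
  let ghat1 := fun w => reinforce Mt s0 pi theta (tau (Ordinal HK) w) in
  let ghat := averaged_reinforce Mt s0 pi theta tau in
  [/\ forall i, 'E_P[fun w => ghat w ord0 i]%E
        = (grad (J Mt s0 mu pi H) theta ord0 i)%:E,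
      grad (J Mt s0 mu pi H) theta = g + gradB,
      (total_variance P ghat1 < +oo)%E ->
        'E_P[fun w => (norm2 (ghat w - g) ^+ 2)%R]%E
        = ((K%:R^-1)%:E * total_variance P ghat1 + (norm2 gradB ^+ 2)%:E)%E &
      gradB <> 0 ->
        ~ (forall i, 'E_P[fun w => ghat w ord0 i]%E = (g ord0 i)%:E) /\
        ((total_variance P ghat1 < +oo)%E ->
          [/\ total_variance P ghat
                = ((K%:R^-1)%:E * total_variance P ghat1)%E,
              0 < norm2 gradB ^+ 2 &
              ((norm2 gradB ^+ 2)%:E
                <= 'E_P[fun w => (norm2 (ghat w - g) ^+ 2)%R])%E]) /\
        forall (K' : nat) (dO' : measure_display) (Omega' : measurableType dO')
          (P' : probability Omega' R)
          (tau' : 'I_K' -> {RV P' >-> H.-tuple (euclidean R da)}),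
        (K < K')%N -> iid_trajectories M s0 mu pi theta tau' ->
        let ghat' := averaged_reinforce Mt s0 pi theta tau' in
        (forall i, 'E_P'[fun w => ghat' w ord0 i]%E
          = (g ord0 i + gradB ord0 i)%:E) /\
        ((total_variance P ghat1 < +oo)%E ->
          (total_variance P' ghat' <= total_variance P ghat)%E /\
          ((0 < total_variance P ghat1)%E ->
            (total_variance P' ghat' < total_variance P ghat)%E))].
Proof.

move=> Mt g gradB ghat1 ghat.
(* [Mt] differs from [M] only in its reward, so every hypothesis not involving the reward transfers
   by unpacking its record. *)
have Mtwf : mdp_wf Mt.
  case: HM => mS mA fS mf mr gamma01; split => //.
  exact: measurable_funD.
have piPt : is_policy Mt mu pi by case: Hpi => *; split.
have piRt : policy_regular Mt mu pi theta by case: Hpi_reg => *; split.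
have rRt : reward_regular Mt s0 mu pi H (reward Mt) theta.
  by have [*] := reward_regularD HM Hpi Hs0 Hr_reg Hb_reg; split.
have tauPt dO1 (Omega1 : measurableType dO1) (P1 : probability Omega1 R) K1
    (tau1 : 'I_K1 -> {RV P1 >-> H.-tuple (euclidean R da)}) :
    iid_trajectories M s0 mu pi theta tau1 -> iid_trajectories Mt s0 mu pi theta tau1.
  by case=> *; split.
(* Dynamics and discount being shared, the return of [Mt] is the return in [M] of the sum of reward
   and bias. *)
have gradE : grad (J Mt s0 mu pi H) theta = g + gradB.
  exact: (grad_expected_returnD HM Hr_reg Hb_reg).
(* The sample and its probability space are left arbitrary because the last conclusion compares with
   a larger sample on another space. *)
have E dO1 (Omega1 : measurableType dO1) (P1 : probability Omega1 R) K1
    (tau1 : 'I_K1 -> {RV P1 >-> H.-tuple (euclidean R da)}) i :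
    (0 < K1)%N -> iid_trajectories M s0 mu pi theta tau1 ->
    'E_P1[fun w => averaged_reinforce Mt s0 pi theta tau1 w ord0 i]%E =
    (g ord0 i + gradB ord0 i)%:E.
  move=> K10 /tauPt tau1P.
  have := has_mean_averaged_reinforce Mtwf piPt piRt Hs0 rRt K10 tau1P i.
  by rewrite gradE mxE => /has_mean_expectation.
have tv1 : total_variance P ghat1 =
    (\sum_(i < d) reinforce_variance Mt mu pi theta s0 H i)%E.
  exact: (total_variance_reinforce Mtwf piPt piRt Hs0 rRt (tauPt _ _ _ _ _ Htau)).
have tvK dO1 (Omega1 : measurableType dO1) (P1 : probability Omega1 R) K1
    (tau1 : 'I_K1 -> {RV P1 >-> H.-tuple (euclidean R da)}) :
    (0 < K1)%N -> iid_trajectories M s0 mu pi theta tau1 ->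
    (total_variance P ghat1 < +oo)%E ->
    total_variance P1 (averaged_reinforce Mt s0 pi theta tau1) =
    (K1%:R^-1%:E * total_variance P ghat1)%E.
  move=> K10 /tauPt tau1P; rewrite tv1.
  exact: (total_variance_averaged_reinforce Mtwf piPt piRt Hs0 rRt K10 tau1P).
have tv1_ge0 : (0 <= total_variance P ghat1)%E.
  by apply: sume_ge0 => i _; exact: variance_ge0.
have mse : (total_variance P ghat1 < +oo)%E ->
    'E_P[fun w => (norm2 (ghat w - g) ^+ 2)%R]%E =
    (K%:R^-1%:E * total_variance P ghat1 + (norm2 gradB ^+ 2)%:E)%E.
  rewrite tv1 => voo.
  rewrite (averaged_reinforce_sqr_error Mtwf piPt piRt Hs0 rRt HK (tauPt _ _ _ _ _ Htau) voo).
  (* The centre is [g] and the mean is [g + gradB], so the squared bias is that of [gradB]. *)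
  by rewrite gradE (_ : g + gradB - g = gradB)// addrAC subrr add0r.
have KV_ge0 : (0 <= K%:R^-1%:E * total_variance P ghat1)%E.
  by rewrite mule_ge0// lee_fin invr_ge0.
split => //.
  by move=> i; rewrite gradE [in RHS]mxE; exact: E.
move=> gradB0; split.
  move=> Eg; apply: gradB0; apply/rowP => i; rewrite [RHS]mxE.
  have := E _ _ _ _ _ i HK Htau; rewrite Eg => -[] gE.
  by apply: (addrI (g ord0 i)); rewrite addr0 -gE.
split.
  move=> voo; split; first exact: tvK.
    rewrite sqr_sqrtr; last by apply: sumr_ge0 => i _; exact: sqr_ge0.
    rewrite lt_neqAle sumr_ge0 ?andbT => [|i _]; last exact: sqr_ge0.
    apply: contra_not_neq gradB0 => /esym/eqP.
    rewrite psumr_eq0 => [/allP B0|i _]; last exact: sqr_ge0.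
    apply/rowP => i; have := B0 i (mem_index_enum i).
    by rewrite /= sqrf_eq0 [RHS]mxE => /eqP.
  by rewrite mse// leeDr.
move=> K' dO' Omega' P' tau' KK' tau'P ghat'.
have K'0 : (0 < K')%N by exact: leq_trans KK'.
have invKK' : K'%:R^-1 < K%:R^-1 :> R.
  by rewrite ltf_pV2 ?ltr_nat// posrE ltr0n.
split; first by move=> i; exact: E.
move=> voo; rewrite !tvK//; split.
  by rewrite lee_wpmul2r// lee_fin ltW.
(* The common factor is positive and finite, so the strict inequality between the inverses
   survives. *)
move=> v0; rewrite lte_pmul2r ?lte_fin//.
by rewrite ge0_fin_numE.
Qed.
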